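(* Let $M$ be a pre-meadow with $\mathbf{a}$. There exists a unique function $(\cdot)^{-1}:M\to M$ such that for all $x,y\in M$ (1) $x\cdot x^{-1}=1+0\cdot x^{-1}$, (2) $(1+0\cdot x)^{-1}=1+0\cdot x$, (3) $(x\cdot y)^{-1}=x^{-1}\cdot y^{-1}$, (4) $0^{-1}=\mathbf{a}$, if and only if for all $x\in M$ the set $$I_x=\{0\cdot z\in 0\cdot M\mid x\cdot z=1+0\cdot z\}$$ has a unique maximal element.
   Context: A pre-meadow is a set $P$ with constants $0,1$, binary operations $+,\cdot$ and a unary operation $-$ such that for all $x,y,z\in P$: $(x+y)+z=x+(y+z)$; $x+y=y+x$; $x+0=x$; $x+(-x)=0\cdot x$; $(x\cdot y)\cdot z=x\cdot(y\cdot z)$; $x\cdot y=y\cdot x$; $1\cdot x=x$; $x\cdot(y+z)=x\cdot y+x\cdot z$; $-(-x)=x$; $0\cdot(x+y)=0\cdot x\cdot y$. Write $0\cdot P=\{0\cdot x\mid x\in P\}$ and $P_z=\{x\in P\mid 0\cdot x=z\}$ for $z\in 0\cdot P$. The set $0\cdot P$ is partially ordered by: $z\leq z'$ if and only if $z\cdot z'=z$. Maximal elements of $I_x$ (where $z$ ranges over $M$) are taken with respect to this order. A pre-meadow with $\mathbf{a}$ is a pre-meadow $M$ such that there is a unique $z\in 0\cdot M$ with $|M_z|=1$, this element being denoted $\mathbf{a}$, and such that $x+\mathbf{a}=\mathbf{a}$ for all $x\in M$.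
   Formalization: ''I_x has a unique maximal element'' is read as: I_x has exactly one maximal element and every element of I_x lies below it; with uniqueness of the maximal element alone, the ''if'' direction fails for some infinite M (the two readings agree for finite M). *)

(* Defs.v *)
Set Implicit Arguments.
Unset Strict Implicit.
Unset Printing Implicit Defensive.

Declare Scope premeadow_scope.
Delimit Scope premeadow_scope with pm.

Record preMeadow : Type := PreMeadow {
  pm_sort :> Type;
  pm_zero : pm_sort;
  pm_one : pm_sort;
  pm_add : pm_sort -> pm_sort -> pm_sort;
  pm_mul : pm_sort -> pm_sort -> pm_sort;
  pm_opp : pm_sort -> pm_sort;
  pm_addA : forall x y z,
    pm_add (pm_add x y) z = pm_add x (pm_add y z);
  pm_addC : forall x y, pm_add x y = pm_add y x;
  pm_addr0 : forall x, pm_add x pm_zero = x;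
  pm_addrN : forall x, pm_add x (pm_opp x) = pm_mul pm_zero x;
  pm_mulA : forall x y z,
    pm_mul (pm_mul x y) z = pm_mul x (pm_mul y z);
  pm_mulC : forall x y, pm_mul x y = pm_mul y x;
  pm_mul1r : forall x, pm_mul pm_one x = x;
  pm_mulDr : forall x y z,
    pm_mul x (pm_add y z) = pm_add (pm_mul x y) (pm_mul x z);
  pm_oppK : forall x, pm_opp (pm_opp x) = x;
  pm_mul0D : forall x y,
    pm_mul pm_zero (pm_add x y) = pm_mul (pm_mul pm_zero x) y
}.

Arguments pm_zero {p}.
Arguments pm_one {p}.

Notation "0" := pm_zero : premeadow_scope.
Notation "1" := pm_one : premeadow_scope.
Notation "x + y" := (pm_add x y) : premeadow_scope.
Notation "x * y" := (pm_mul x y) : premeadow_scope.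
Notation "- x" := (pm_opp x) : premeadow_scope.

Local Open Scope premeadow_scope.

Section PreMeadowTheory.
Variable P : preMeadow.
Implicit Types x y z m a : P.

(* [zeros] is the set 0 * P, and [component z] the set P_z. *)
Definition zeros : P -> Prop := fun z => exists x, z = 0 * x.

Definition component z : P -> Prop := fun x => 0 * x = z.

(* A partial order on [zeros] only; it is used only between elements of
   [zeros]. *)
Definition zle z z' : Prop := z * z' = z.

Definition is_singleton (S : P -> Prop) : Prop := exists! x, S x.

Definition is_bold_a a : Prop :=
  unique (fun z => zeros z /\ is_singleton (component z)) a /\
  (forall x, x + a = a).

Definition maximal_in (S : P -> Prop) m : Prop :=
  S m /\ (forall w, S w -> zle m w -> w = m).

(* "S has a unique maximal element", read as: S has exactly one maximal element
   and every element of S lies below it. The second clause is automatic when P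
   is finite. In an infinite poset it does not follow from the first (take an
   isolated maximal element next to an unbounded chain), but the sets I_x have
   it as soon as some function satisfies [is_inverse]. *)
Definition has_unique_maximal (S : P -> Prop) : Prop :=
  exists m, unique (maximal_in S) m /\ (forall w, S w -> zle w m).

(* The set I_x: its elements are the 0 * z, not the z themselves. *)
Definition inv_set x : P -> Prop :=
  fun w => exists z, w = 0 * z /\ x * z = 1 + 0 * z.

End PreMeadowTheory.

Record preMeadowWithA : Type := PreMeadowWithA {
  pma_sort :> preMeadow;
  bold_a : pma_sort;
  bold_aP : is_bold_a bold_a
}.

Arguments bold_a {p}.

Definition is_inverse (M : preMeadowWithA) (inv : M -> M) : Prop :=
  (forall x : M, x * inv x = 1 + 0 * inv x) /\
  (forall x : M, inv (1 + 0 * x) = 1 + 0 * x) /\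
  (forall x y : M, inv (x * y) = inv x * inv y) /\
  inv 0 = bold_a.

(* Main.v *)
(** The relation x z = 1 + 0 z is that of a partial inverse: it forces
    0 z <= 0 x, and z is determined by x and 0 z, because z (1 + 0 z) = z.
    Any function satisfying (1)-(3) picks a partial inverse of x with the largest
    0 z: if x z = 1 + 0 z, then applying it to this equation gives
    1 + 0 z = x^-1 z^-1, so 0 z <= 0 x^-1. Hence the function is unique and
    0 x^-1 is the greatest element of I_x. Conversely, a partial inverse of x y
    yields partial inverses of x and of y with the same 0 z, which makes the
    choice of the largest partial inverses multiplicative. *)

From Stdlib Require Import ssreflect FunctionalExtensionality ClassicalEpsilon.
Require Import Defs.

Set Implicit Arguments.
Unset Strict Implicit.
Unset Printing Implicit Defensive.

Local Open Scope premeadow_scope.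

Section PreMeadowArithmetic.
Variable P : preMeadow.
Implicit Types x y z t w : P.

Lemma mul00 : 0 * 0 = 0 :> P.
Proof.
have := pm_mul0D (1 : P) 0.
by rewrite pm_addr0 (pm_mulC 0 1) pm_mul1r => <-.
Qed.

Lemma mul0K x : 0 * (0 * x) = 0 * x.
Proof. by rewrite -pm_mulA mul00. Qed.

Lemma addr0r x : x + 0 * x = x.
Proof.
by rewrite -{1}(pm_mul1r x) !(pm_mulC _ x) -pm_mulDr pm_addr0 pm_mulC pm_mul1r.
Qed.

Lemma mul0M x y : 0 * (x * y) = (0 * x) * (0 * y).
Proof.
by rewrite -{1}mul00 !pm_mulA (pm_mulC x (0 * y)) pm_mulA (pm_mulC y).
Qed.

Lemma add_zeros x y : 0 * x + 0 * y = (0 * x) * (0 * y).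
Proof. by rewrite -pm_mulDr pm_mul0D -mul0M pm_mulA. Qed.

Lemma mul0_idem x : (0 * x) * (0 * x) = 0 * x.
Proof. by rewrite -add_zeros -{2}(mul0K x) addr0r. Qed.

Lemma mulr0r x : x * (0 * x) = 0 * x.
Proof. by rewrite -[RHS]mul0_idem -mul0M pm_mulC pm_mulA. Qed.

Lemma mul0_add1 x : 0 * (1 + 0 * x) = 0 * x.
Proof. by rewrite pm_mul0D pm_mulA pm_mul1r mul0K. Qed.

Lemma mulr_add1 x : x * (1 + 0 * x) = x.
Proof. by rewrite pm_mulDr mulr0r pm_mulC pm_mul1r addr0r. Qed.

Lemma mul_add1 x y : (1 + 0 * x) * (1 + 0 * y) = 1 + 0 * (x * y).
Proof.
rewrite pm_mulDr (pm_mulC _ 1) pm_mul1r (pm_mulC _ (0 * y)) pm_mulDr.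
rewrite (pm_mulC _ 1) pm_mul1r (pm_mulC (0 * y)) -mul0M.
(* The terms [0 * x + 0 * y] make a second copy of [0 * (x * y)], which the first one absorbs. *)
rewrite pm_addA -(pm_addA (0 * x)) add_zeros -mul0M.
by rewrite -{2}(mul0K (x * y)) addr0r.
Qed.

Lemma zle_anti z w : zle z w -> zle w z -> z = w.
Proof. by move=> zw wz; rewrite -zw pm_mulC. Qed.

Definition partial_inverse x z : Prop := x * z = 1 + 0 * z.

(** The values [0 * t] for partial inverses [t] of [x] are exactly the elements of [inv_set x], so
    [0 * z] is its greatest element. *)
Definition largest_inverse x z : Prop :=
  partial_inverse x z /\ forall t, partial_inverse x t -> zle (0 * t) (0 * z).

Lemma partial_inverse_le x z : partial_inverse x z -> (0 * x) * (0 * z) = 0 * z.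
Proof. by move=> xz; rewrite -mul0M xz mul0_add1. Qed.

Lemma partial_inverse_unique x z t :
  partial_inverse x z -> partial_inverse x t -> 0 * z = 0 * t -> z = t.
Proof.
move=> xz xt zt.
(* Both [z] and [t] equal [z * x * t]. *)
rewrite -(mulr_add1 z) zt -xt -pm_mulA (pm_mulC z) xz zt.
by rewrite pm_mulC mulr_add1.
Qed.

Lemma largest_inverse_unique x z t :
  largest_inverse x z -> largest_inverse x t -> z = t.
Proof.
move=> [xz maxz] [xt maxt]; apply: (partial_inverse_unique xz xt).
by apply: zle_anti; [apply: maxt | apply: maxz].
Qed.

Lemma partial_inverseM x y z t :
  partial_inverse x z -> partial_inverse y t -> partial_inverse (x * y) (z * t).
Proof.
move=> xz yt; rewrite /partial_inverse -mul_add1 -xz -yt.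
by rewrite !pm_mulA -(pm_mulA y) -(pm_mulA z) (pm_mulC y z).
Qed.

(** Since [0 * t] lies below [0 * (x * y)], it lies below [0 * y], so the factor [y] leaves it
    unchanged. *)
Lemma partial_inverse_factor x y t :
  partial_inverse (x * y) t ->
  partial_inverse x (y * t) /\ 0 * (y * t) = 0 * t.
Proof.
move=> xyt.
have yt : 0 * (y * t) = 0 * t.
  have := partial_inverse_le xyt.
  rewrite mul0M (pm_mulC (0 * x)) (pm_mulA (0 * y)) => yxt.
  by rewrite mul0M -{1}yxt -pm_mulA mul0_idem.
by split=> //; rewrite /partial_inverse yt -pm_mulA.
Qed.

Lemma largest_inverseM x y z t :
  largest_inverse x z -> largest_inverse y t -> largest_inverse (x * y) (z * t).
Proof.
move=> [xz maxz] [yt maxt]; split; first exact: partial_inverseM.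
move=> s xys.
have [xys' ys] := partial_inverse_factor xys.
rewrite (pm_mulC x) in xys.
have [yxs' xs] := partial_inverse_factor xys.
(* Now [0 * s] lies below both [0 * z] and [0 * t], hence below their product, which is their
   meet. *)
have := maxt _ yxs'; have := maxz _ xys'.
by rewrite ys xs /zle => sz st; rewrite mul0M -(pm_mulA (0 * s) (0 * z)) sz.
Qed.

Lemma largest_inverse_add1 x : largest_inverse (1 + 0 * x) (1 + 0 * x).
Proof.
split; first by rewrite /partial_inverse mul_add1 mul0_add1 mul0M mul0_idem.
by move=> t /partial_inverse_le; rewrite mul0_add1 /zle pm_mulC.
Qed.

Lemma has_unique_maximal_inv_setP x :
  has_unique_maximal (inv_set x) <-> exists z, largest_inverse x z.
Proof.
split=> [[m [[[[z [-> xz]] _] _] maxm]] | [z [xz maxz]]].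
  by exists z; split=> // t xt; apply: maxm; exists t.
have mz : inv_set x (0 * z) by exists z.
have le_z w : inv_set x w -> zle w (0 * z).
  by move=> [t [-> xt]]; apply: maxz.
exists (0 * z); split=> //; split.
  by split=> // w /le_z wz zw; apply: zle_anti.
by move=> w [xw maxw]; apply: maxw => //; apply: le_z.
Qed.

End PreMeadowArithmetic.

Section PreMeadowWithAArithmetic.
Variable M : preMeadowWithA.
Implicit Types x z : M.

(** Any [y] with [0 * y = 0 * z] satisfies [y = y * (1 + 0 * y) = y * (0 * y) = 0 * y], so the
    component of [0 * z] is a singleton. *)
Lemma zeros_eq_add1 z : 0 * z = 1 + 0 * z -> 0 * z = bold_a.
Proof.
move=> z1; have [[_ a_unique] _] := bold_aP M.
symmetry; apply: a_unique; split; first by exists z.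
exists (0 * z); split; first exact: mul0K.
by move=> y yz; rewrite -(mulr_add1 y) yz -z1 -yz mulr0r.
Qed.

(** Being of the form [0 * x], [bold_a] lies in its own component, which has only one element. *)
Lemma mul0_eq_bold_a z : 0 * z = bold_a -> z = bold_a.
Proof.
have [[[[x ->] [y [_ y_unique]]] _] _] := bold_aP M.
by move=> zx; rewrite -(y_unique z zx); apply: y_unique; apply: mul0K.
Qed.

Lemma partial_inverse0 z : partial_inverse 0 z -> z = bold_a.
Proof. by move=> z1; apply: mul0_eq_bold_a; apply: zeros_eq_add1. Qed.

(** Makes the conditions on [inv] pointwise, so that existence and uniqueness can be settled at each
    [x] separately. *)
Lemma is_inverseP (inv : M -> M) :
  is_inverse inv <-> forall x, largest_inverse x (inv x).
Proof.
split=> [[inv1 [inv2 [inv3 _]]] x | inv_max].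
  split=> [|z xz]; first exact: inv1.
  have z_inv : 0 * z = (0 * inv x) * (0 * inv z).
    by rewrite -mul0M -inv3 xz inv2 mul0_add1.
  by rewrite /zle z_inv pm_mulC -pm_mulA mul0_idem.
split; first by move=> x; case: (inv_max x).
split.
  move=> x; apply: (largest_inverse_unique (inv_max _)).
  exact: largest_inverse_add1.
split; last by apply: partial_inverse0; case: (inv_max 0).
move=> x y; apply: (largest_inverse_unique (inv_max _)).
exact: largest_inverseM.
Qed.

End PreMeadowWithAArithmetic.

Theorem theorem2p11 (M : preMeadowWithA) :
  (exists! inv : M -> M, is_inverse inv) <->
  (forall x : M, has_unique_maximal (inv_set x)).
Proof.
split=> [[inv [/is_inverseP inv_max _]] x | max].
  by apply/has_unique_maximal_inv_setP; exists (inv x).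
(* Choice selects a largest partial inverse of each [x]; these values form the required function. *)
have {}max (x : M) : {z | largest_inverse x z}.
  apply: constructive_indefinite_description.
  by apply/has_unique_maximal_inv_setP; apply: max.
exists (fun x => proj1_sig (max x)); split.
  by apply/is_inverseP => x; case: (max x).
move=> inv /is_inverseP inv_max; apply: functional_extensionality => x.
by case: (max x) => z z_max; apply: (largest_inverse_unique z_max).
Qed.
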